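(* Let $\mathbb{F}_q$ be a finite field of odd characteristic and let $\epsilon,\delta\in\mathbb{F}_q$ with $\epsilon(\delta^2-\epsilon)\neq 0$ and $\chi(\delta^2-\epsilon)=1$. Fix a square root $\sqrt{\delta^2-\epsilon}\in\mathbb{F}_q$ and let $s=-\delta-\sqrt{\delta^2-\epsilon}$. Then the Jacobi quartic curve $J_{\epsilon,\delta}: y^2=\epsilon x^4+2\delta x^2+1$ over $\mathbb{F}_q$ has dADD-M formulas with the function $$w(x,y)=\frac{s x^2-\epsilon x^4}{1-s x^2}$$ and $e=\dfrac{4(-\delta+\sqrt{\delta^2-\epsilon})}{-\delta-\sqrt{\delta^2-\epsilon}}$; that is, $w$ is an inverted Montgomery-like function on $J_{\epsilon,\delta}$ with parameter $e$.
   Context: $\chi$ is the quadratic character of $\mathbb{F}_q$: for $a\ne0$, $\chi(a)=1$ if $a$ is a square in $\mathbb{F}_q$ and $\chi(a)=-1$ otherwise. The Jacobi quartic curve $J_{\epsilon,\delta}$ is regarded as an elliptic curve through its smooth projective model $X^2=TZ$, $Y^2=\epsilon T^2+2\delta X^2+Z^2$ in $\mathbb{P}^3$ with coordinates $(X:Y:T:Z)$, the affine point $(x,y)$ being $(x:y:x^2:1)$; the points with $Z=0$ are $(0:\pm\sqrt{\epsilon}:1:0)$. The identity is $(0,1)$, $-(x,y)=(-x,y)$, and addition is generically $$(x_1,y_1)+(x_2,y_2)=\left(\frac{x_1y_2+x_2y_1}{1-\epsilon x_1^2x_2^2},\ \frac{(y_1y_2+2\delta x_1x_2)(1+\epsilon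 x_1^2x_2^2)+2\epsilon x_1x_2(x_1^2+x_2^2)}{(1-\epsilon x_1^2x_2^2)^2}\right).$$ Inverted Montgomery-like function: let $E$ be an elliptic curve over a field $\mathbb{F}$ of characteristic $\neq2$ and $w$ a rational function on $E$ with $w(P)=w(-P)$ for all $P$. View $w(P)$ in $\mathbb{P}^1(\mathbb{F})$ as $(w(P):1)$ if $w$ is regular at $P$ and $(1:0)$ otherwise. For $P_1,P_2\in E(\mathbb{F})$ put $(W_0:Z_0)=w(P_2-P_1)$, $(W_1:Z_1)=w(P_1)$, $(W_2:Z_2)=w(P_2)$, $(W_3:Z_3)=w(P_1+P_2)$, $(W_4:Z_4)=w(2P_1)$. Then $w$ is an inverted Montgomery-like function with parameter $e\in\mathbb{F}$ if for all $P_1,P_2\in E(\mathbb{F})$ with $W_0Z_0\neq0$, $$(W_4:Z_4)=\big(4W_1Z_1((W_1+Z_1)^2-eW_1Z_1):(W_1^2-Z_1^2)^2\big),$$ $$(W_3:Z_3)=\big(Z_0(W_1Z_2-W_2Z_1)^2:W_0(W_1W_2-Z_1Z_2)^2\big).$$ (Equivalently $1/w$ is a Montgomery-like function, given by the same formulas with the two coordinates swapped; a curve with such a function is said to have dADD-M formulas.) *)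

(* Defs.v *)
From HB Require Import structures.
From mathcomp Require Import all_boot all_algebra.
From mathcomp Require Import boolp.
From mathcomp Require Import mpoly ring.

Set Implicit Arguments.
Unset Strict Implicit.
Unset Printing Implicit Defensive.

Import GRing.Theory.
Local Open Scope ring_scope.

Definition quad_char (F : finFieldType) (a : F) : int :=
  if a == 0 then 0 else if [exists b : F, b ^+ 2 == a] then 1 else -1.

(* Homogeneous coordinates on P^1: a point is a nonzero pair up to scaling, so
   (0, 0) is equal to nothing, itself included. *)
Definition p1_eq (F : fieldType) (u v : F * F) : bool :=
  [&& u != 0, v != 0 & u.1 * v.2 == v.1 * u.2].

(* Homogeneous coordinates (X : Y : T : Z) on P^3. *)
Record pt4 (F : Type) := Pt4 { cX : F; cY : F; cT : F; cZ : F }.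

Section JacobiQuartic.

Variable F : fieldType.
Variables eps delta : F.

Implicit Types P Q : pt4 F.

Definition pt_nz P : bool :=
  [|| cX P != 0, cY P != 0, cT P != 0 | cZ P != 0].

Definition pt_eq P Q : Prop :=
  exists2 c : F, c != 0 &
    P = Pt4 (c * cX Q) (c * cY Q) (c * cT Q) (c * cZ Q).

Definition on_jq P : bool :=
  [&& pt_nz P, cX P ^+ 2 == cT P * cZ P
    & cY P ^+ 2 == eps * cT P ^+ 2 + 2 * delta * cX P ^+ 2 + cZ P ^+ 2].

Definition jq_affine (x y : F) : pt4 F := Pt4 x y (x ^+ 2) 1.

(* -(x, y) = (-x, y); both points at infinity (0 : Y : 1 : 0) are fixed. *)
Definition jq_opp P : pt4 F := Pt4 (- cX P) (cY P) (cT P) (cZ P).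

(* The generic affine addition formula with denominators cleared, i.e.
   multiplied by (1 - eps x1^2 x2^2)^2, and x_i^2 replaced by T_i / Z_i. *)
Definition jq_law1 P Q : pt4 F :=
  let a := cX P * cY Q + cX Q * cY P in
  let b := cZ P * cZ Q - eps * cT P * cT Q in
  Pt4 (a * b)
      ((cY P * cY Q + 2 * delta * cX P * cX Q)
         * (cZ P * cZ Q + eps * cT P * cT Q)
       + 2 * eps * cX P * cX Q * (cT P * cZ Q + cT Q * cZ P))
      (a ^+ 2)
      (b ^+ 2).

(* The same morphism in other coordinates, coming from
   (x1 y2 + x2 y1) (x1 y2 - x2 y1) = (x1^2 - x2^2) (1 - eps x1^2 x2^2)
   on the curve.  It is needed because jq_law1 vanishes identically when P - Q
   is a point at infinity. *)
Definition jq_law2 P Q : pt4 F :=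
  let a := cT P * cZ Q - cT Q * cZ P in
  let b := cX P * cY Q - cX Q * cY P in
  Pt4 (a * b)
      ((cT P * cZ Q + cT Q * cZ P)
         * (cY P * cY Q - 2 * delta * cX P * cX Q)
       - 2 * cX P * cX Q * (cZ P * cZ Q + eps * cT P * cT Q))
      (a ^+ 2)
      (b ^+ 2).

(* The group law.  jq_law1 and jq_law2 define the same point wherever both are
   nonzero (jq_laws_agree), and on a smooth curve they have no common zero
   (jq_add_on), so this is the morphism extending the generic formula. *)
Definition jq_add P Q : pt4 F :=
  if pt_nz (jq_law1 P Q) then jq_law1 P Q else jq_law2 P Q.

Definition coord4 P (i : 'I_4) : F := nth 0 [:: cX P; cY P; cT P; cZ P] i.

Definition mX : {mpoly F[4]} := 'X_(@Ordinal 4 0 isT).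
Definition mY : {mpoly F[4]} := 'X_(@Ordinal 4 1 isT).
Definition mT : {mpoly F[4]} := 'X_(@Ordinal 4 2 isT).
Definition mZ : {mpoly F[4]} := 'X_(@Ordinal 4 3 isT).

(* The homogeneous ideal of the curve (for a smooth curve the two quadrics
   generate a prime ideal). *)
Definition jq_ideal (p : {mpoly F[4]}) : Prop :=
  exists a b : {mpoly F[4]},
    p = a * (mX ^+ 2 - mT * mZ)
      + b * (mY ^+ 2 - (eps *: mT ^+ 2 + (2 * delta) *: mX ^+ 2 + mZ ^+ 2)).

(* A rational function on the curve is represented by a fraction w.1 / w.2 of
   forms of the same degree, w.2 not vanishing identically on the curve. *)
Definition is_ratfun (w : {mpoly F[4]} * {mpoly F[4]}) : Prop :=
  (exists d : nat, w.1 \is d.-homog /\ w.2 \is d.-homog) /\ ~ jq_ideal w.2.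

Definition ratfun_eqv (w w' : {mpoly F[4]} * {mpoly F[4]}) : Prop :=
  jq_ideal (w.1 * w'.2 - w'.1 * w.2).

Definition regular_repr w P (w' : {mpoly F[4]} * {mpoly F[4]}) : Prop :=
  [/\ is_ratfun w', ratfun_eqv w w' & w'.2.@[coord4 P] != 0].

(* w(P) in P^1: (w(P) : 1) if w is regular at P, i.e. if some fraction equal to
   w in the function field has a denominator nonzero at P, else (1 : 0). *)
Definition ratfun_at (w : {mpoly F[4]} * {mpoly F[4]}) P : F * F :=
  if pselect (exists w', regular_repr w P w') is left h then
    let w' := projT1 (cid h) in (w'.1.@[coord4 P] / w'.2.@[coord4 P], 1)
  else (1, 0).

(* (s x^2 - eps x^4) / (1 - s x^2) at x = X / Z (jq_w_affine).  Both forms vanish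
   at the points with Z = 0; ratfun_at reads the value there off an equivalent
   fraction. *)
Definition jq_w (s : F) : {mpoly F[4]} * {mpoly F[4]} :=
  (s *: (mX ^+ 2 * mZ ^+ 2) - eps *: mX ^+ 4,
   mZ ^+ 4 - s *: (mX ^+ 2 * mZ ^+ 2)).

End JacobiQuartic.

Section InvertedMontgomery.

Variable F : fieldType.
Variables eps delta : F.

(* w(-P) = w(P) for the points P over all extension fields of F. *)
Definition even_ratfun (w : {mpoly F[4]} * {mpoly F[4]}) : Prop :=
  forall (L : fieldType) (iota : {rmorphism F -> L}) (P : pt4 L),
    on_jq (iota eps) (iota delta) P ->
    let wL := (map_mpoly iota w.1, map_mpoly iota w.2) in
    p1_eq (ratfun_at (iota eps) (iota delta) wL (jq_opp P))
          (ratfun_at (iota eps) (iota delta) wL P).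

Definition inverted_montgomery_like
    (w : {mpoly F[4]} * {mpoly F[4]}) (e : F) : Prop :=
  let val := ratfun_at eps delta w in
  let add := jq_add eps delta in
  [/\ is_ratfun eps delta w,
      even_ratfun w &
      forall P1 P2 : pt4 F, on_jq eps delta P1 -> on_jq eps delta P2 ->
      forall W0 Z0 W1 Z1 W2 Z2 W3 Z3 W4 Z4 : F,
        p1_eq (W0, Z0) (val (add P2 (jq_opp P1))) ->
        p1_eq (W1, Z1) (val P1) ->
        p1_eq (W2, Z2) (val P2) ->
        p1_eq (W3, Z3) (val (add P1 P2)) ->
        p1_eq (W4, Z4) (val (add P1 P1)) ->
        W0 * Z0 != 0 ->
        p1_eq (W4, Z4)
              (4 * W1 * Z1 * ((W1 + Z1) ^+ 2 - e * W1 * Z1),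
               (W1 ^+ 2 - Z1 ^+ 2) ^+ 2)
        /\
        p1_eq (W3, Z3)
              (Z0 * (W1 * Z2 - W2 * Z1) ^+ 2,
               W0 * (W1 * W2 - Z1 * Z2) ^+ 2)].

End InvertedMontgomery.

Section GroupLawFacts.

Variable F : fieldType.
Variables eps delta : F.

Lemma jq_laws_agree (P Q : pt4 F) :
  on_jq eps delta P -> on_jq eps delta Q ->
  pt_nz (jq_law1 eps delta P Q) -> pt_nz (jq_law2 eps delta P Q) ->
  pt_eq (jq_law1 eps delta P Q) (jq_law2 eps delta P Q).
Proof.
case: P Q => [X1 Y1 T1 Z1] [X2 Y2 T2 Z2].
case/and3P=> /= _ /eqP hX1 /eqP hY1 /and3P[/= _ /eqP hX2 /eqP hY2].
rewrite hX1 in hY1; rewrite hX2 in hY2.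
have XY : forall a b c d a' b' c' d' : F,
  pt_nz (Pt4 a b c d) -> pt_nz (Pt4 a' b' c' d') ->
  a * b' = a' * b -> a * c' = a' * c -> a * d' = a' * d ->
  b * c' = b' * c -> b * d' = b' * d -> c * d' = c' * d ->
  pt_eq (Pt4 a b c d) (Pt4 a' b' c' d').
  move=> a b c d a' b' c' d' nz nz' h1 h2 h3 h4 h5 h6.
  have key : forall k k', k' != 0 -> a * k' = a' * k -> b * k' = b' * k ->
     c * k' = c' * k -> d * k' = d' * k -> pt_eq (Pt4 a b c d) (Pt4 a' b' c' d').
    move=> k k' k'0 ha hb hc hd.
    have E u u' : u * k' = u' * k -> u = k / k' * u'.
      by move=> hu; apply: (mulIf k'0); rewrite hu mulrAC divfK // mulrC.
    exists (k / k') => /=; last by congr Pt4; apply: E.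
    rewrite mulf_neq0 ?invr_eq0 //; apply: contraTneq nz => k0.
    by rewrite /pt_nz /= (E _ _ ha) (E _ _ hb) (E _ _ hc) (E _ _ hd) k0 !mul0r eqxx.
  by case/or4P: (nz') => /= n0;
    [apply: (key a _ n0)|apply: (key b _ n0)|apply: (key c _ n0)|apply: (key d _ n0)];
    first [exact: mulrC | done | by rewrite mulrC [RHS]mulrC].
move=> nz1 nz2; apply: (XY _ _ _ _ _ _ _ _ nz1 nz2) => /=;
  ring: hX1 hX2 hY1 hY2.
Qed.

Lemma jq_add_on (P Q : pt4 F) :
  (2 : F) != 0 -> eps * (delta ^+ 2 - eps) != 0 ->
  on_jq eps delta P -> on_jq eps delta Q ->
  on_jq eps delta (jq_add eps delta P Q).
Proof.
move=> n2; rewrite mulf_eq0 negb_or => /andP[e0 d0].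
have nzTZ (P' : pt4 F) : on_jq eps delta P' -> cT P' = 0 -> cZ P' != 0.
  case: P' => X Y T Z /and3P[/= nz /eqP hX /eqP hY] T0.
  apply: contraTneq nz => Z0; rewrite T0 Z0 mulr0 in hX.
  have /eqP : X = 0 by apply/eqP; rewrite -sqrf_eq0 hX.
  move=> /eqP X0; rewrite /pt_nz /= X0 T0 Z0 eqxx /= orbF.
  rewrite T0 Z0 X0 in hY; rewrite negbK -sqrf_eq0 hY; apply/eqP; ring.
move=> onP onQ; have := (nzTZ P onP, nzTZ Q onQ); move: onP onQ.
case: P Q => [X1 Y1 T1 Z1] [X2 Y2 T2 Z2].
case/and3P=> /= _ /eqP hX1 /eqP hY1 /and3P[/= _ /eqP hX2 /eqP hY2] [nz1 nz2].
rewrite hX1 in hY1; rewrite hX2 in hY2.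
rewrite /jq_add; case: ifPn => [nz|].
  apply/and3P; split=> //=; apply/eqP; ring: hX1 hX2 hY1 hY2.
rewrite /pt_nz /= !negb_or !negbK => /and4P[_ _ + +].
rewrite !sqrf_eq0 => /eqP Ea /eqP Eb.
apply/and3P; split=> /=;
  [|by apply/eqP; ring: hX1 hX2 hY1 hY2|by apply/eqP; ring: hX1 hX2 hY1 hY2].
rewrite /pt_nz /= !sqrf_eq0; apply/negPn/negP.
rewrite !negb_or !negbK => /and4P[_ _ /eqP Ec /eqP Ed].
have T1n : T1 != 0.
  apply/eqP => T0; have Z1n := nz1 T0; move: Eb Ec; rewrite T0 !(mulr0, mul0r, subr0, sub0r).
  move/eqP; rewrite mulf_eq0 (negPf Z1n) /= => /eqP Z2E /eqP.
  by rewrite oppr_eq0 mulf_eq0 (negPf Z1n) orbF => /eqP /nz2; rewrite Z2E eqxx.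
have T2n : T2 != 0.
  apply/eqP => T0; have Z2n := nz2 T0; move: Ec; rewrite T0 mul0r subr0 => /eqP.
  by rewrite mulf_eq0 (negPf T1n) (negPf Z2n).
have ZZ : Z1 * Z2 = eps * T1 * T2 by apply/eqP; rewrite -subr_eq0 Eb.
have ZZn : Z1 * Z2 != 0 by rewrite ZZ !mulf_neq0.
have /andP[Z1n Z2n] : (Z1 != 0) && (Z2 != 0) by rewrite -negb_or -mulf_eq0.
have XY : X1 * Y2 = 0.
  apply/eqP; have /eqP : 2 * (X1 * Y2) = 0.
    by rewrite -[RHS]addr0 -{1}Ea -Ed; ring.
  by rewrite mulf_eq0 (negPf n2).
have X1n : X1 != 0 by rewrite -sqrf_eq0 hX1 mulf_neq0.
have Y2E : Y2 = 0 by apply/eqP; move/eqP: XY; rewrite mulf_eq0 (negPf X1n).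
have TZ : T1 * Z2 = T2 * Z1 by apply/eqP; rewrite -subr_eq0 Ec.
have ZE : Z2 ^+ 2 = eps * T2 ^+ 2.
  apply: (mulfI T1n); rewrite expr2 mulrA TZ -mulrA ZZ; ring.
have /eqP : 2 * T2 * (eps * T2 + delta * Z2) = 0.
  transitivity (Y2 ^+ 2); last by rewrite Y2E expr0n.
  rewrite hY2 ZE; ring.
rewrite !mulf_eq0 (negPf n2) (negPf T2n) /= => /eqP H.
have /eqP : (delta ^+ 2 - eps) * (eps * T2 ^+ 2) = 0.
  by rewrite mulrBl -{1}ZE -[RHS](mul0r (delta * Z2 - eps * T2)) -H; ring.
by rewrite mulf_eq0 (negPf d0) mulf_eq0 (negPf e0) sqrf_eq0 (negPf T2n).
Qed.

Lemma jq_add_affine (x1 y1 x2 y2 : F) :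
  1 - eps * x1 ^+ 2 * x2 ^+ 2 != 0 ->
  pt_eq (jq_add eps delta (jq_affine x1 y1) (jq_affine x2 y2))
    (jq_affine
      ((x1 * y2 + x2 * y1) / (1 - eps * x1 ^+ 2 * x2 ^+ 2))
      (((y1 * y2 + 2 * delta * x1 * x2) * (1 + eps * x1 ^+ 2 * x2 ^+ 2)
        + 2 * eps * x1 * x2 * (x1 ^+ 2 + x2 ^+ 2))
       / (1 - eps * x1 ^+ 2 * x2 ^+ 2) ^+ 2)).
Proof.
move=> d0; have d0' : 1 * 1 - eps * x1 ^+ 2 * x2 ^+ 2 != 0 by rewrite mulr1.
rewrite /jq_add; case: ifPn => [_|]; last first.
  by rewrite /pt_nz /= (expf_neq0 2 d0') !orbT.
exists ((1 - eps * x1 ^+ 2 * x2 ^+ 2) ^+ 2); first by rewrite sqrf_eq0.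
by rewrite /jq_law1 /=; congr Pt4; field.
Qed.

Lemma jq_w_affine (s x y : F) :
  let v := coord4 (jq_affine x y) in
  (jq_w eps s).1.@[v] / (jq_w eps s).2.@[v]
    = (s * x ^+ 2 - eps * x ^+ 4) / (1 - s * x ^+ 2).
Proof.
by rewrite /jq_w /mX /mZ !mevalB !mevalZ !mevalM !mevalXU /coord4 /= !mulr1.
Qed.

End GroupLawFacts.

(* Main.v *)
Require Import Defs.
From mathcomp Require Import all_boot all_algebra.
From mathcomp Require Import boolp.
From mathcomp Require Import mpoly ring.

Set Implicit Arguments.
Unset Strict Implicit.
Unset Printing Implicit Defensive.

Import GRing.Theory.
Import Pdiv.Ring.
Local Open Scope ring_scope.

(** Put s' = - delta + r, the other root of X^2 + 2 delta X + eps.  Then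
    s s' = eps, s + s' = - 2 delta, and the curve becomes
    y^2 = (1 - s x^2) (1 - s' x^2), so that
    w = s x^2 (1 - s' x^2) / (1 - s x^2).  In the coordinates T, Z this is
    N : D with N = T (s Z - eps T) and D = Z (Z - s T); these two forms have
    no common zero on the curve because s <> s'.

    Values of w.  Where Z <> 0 the given fraction defines w and agrees with
    N : D.  At a point with Z = 0 both of its forms vanish, and w must be shown
    to have a pole: no equivalent fraction has a nonzero denominator there
    ([jq_w_pole_at_inf]).  Near such a point x = X / T is a local parameter, and
    the cross-multiplied relation with another fraction, divided by the power
    of x common to both forms of w, evaluates to - eps times the other
    denominator.  Dividing is legitimate since the coordinate ring
    F[x][y] / (y^2 - f(x)) of this chart is free over F[x].  Evenness follows
    at once, as N and D do not involve X.

    Doubling.  For P + P the addition law has T = a^2, Z = b^2 with a = 2 X Y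
    and b = Z^2 - eps T^2.  Here b = N + D and s a^2 = 4 N D, from which both
    coordinates of w (2 P) can be read off ([w_double]).

    Differential addition.  Let a and a' be the numerators of the
    x-coordinates of P + Q and Q - P, and b their common denominator.  The
    curve equations give a a' = t b with t = T_Q Z_P - T_P Z_Q
    ([sum_diff]) and (b^2 - r a^2) (b^2 - r a'^2) = b^2 U_r^2 for r = s and
    r = s', where U_r is bilinear in the (T, Z) ([U_sq_factor]).  Since
    w (P + Q) w (Q - P) is a ratio of such products, it equals
    (s t U_s')^2 / (b U_s)^2, and the two roots are, up to sign,
    N_P D_Q - N_Q D_P and N_P N_Q - D_P D_Q.  When b = 0 one of the two points
    is at infinity; the hypothesis w (Q - P) <> 0, oo makes it P + Q, where
    both sides are oo. *)

(** * Homogeneous coordinates on the projective line *)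

Lemma pair_neq0 (F : fieldType) (a b : F) :
  ((a, b) != 0) = (a != 0) || (b != 0).
Proof. by rewrite -[0]/(0, 0) xpair_eqE negb_and. Qed.

Lemma p1_eq_scaleP (F : fieldType) (u v : F * F) :
  reflect (v != 0 /\ exists2 c, c != 0 & u = (c * v.1, c * v.2)) (p1_eq u v).
Proof.
case: u v => [a b] [a' b']; rewrite /p1_eq /=.
apply: (iffP and3P) => [[nu nv /eqP E]|[nv [c c0 [-> ->]]]]; last first.
  split=> //; last by apply/eqP; ring.
  by move: nv; rewrite !pair_neq0 !mulf_eq0 (negPf c0).
split=> //; move: nu nv; rewrite !pair_neq0.
have [a'0|a'n] /= := eqVneq a' 0.
  move: E; rewrite a'0 mul0r => /eqP; rewrite mulf_eq0 => /orP[/eqP->|/eqP->];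
  rewrite eqxx //= => nb nb'.
  exists (b / b'); first by rewrite mulf_neq0 // invr_eq0.
  by rewrite mulr0 divfK.
move=> nu _; exists (a / a'); last by congr pair; [rewrite divfK | field: E].
rewrite mulf_neq0 ?invr_eq0 //; apply: contraTneq nu => a0.
by move/esym/eqP: E; rewrite a0 mul0r mulf_eq0 (negPf a'n) /= => /eqP ->;
  rewrite eqxx.
Qed.

Lemma p1_eq_sym (F : fieldType) (u v : F * F) : p1_eq u v = p1_eq v u.
Proof. by rewrite /p1_eq andbCA [u.1 * v.2 == _]eq_sym. Qed.

Lemma p1_eq_trans (F : fieldType) : transitive (@p1_eq F).
Proof.
move=> v u w /p1_eq_scaleP[_ [c c0 ->]] /p1_eq_scaleP[w0 [c' c'0 ->]].
apply/p1_eq_scaleP; split=> //; exists (c * c'); first exact: mulf_neq0.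
by rewrite /= !mulrA.
Qed.

Lemma p1_eq_scale (F : fieldType) (a b a' b' c c' : F) : c != 0 -> c' != 0 ->
  p1_eq (a, b) (a', b') -> p1_eq (c * a, c * b) (c' * a', c' * b').
Proof.
move=> c0 c'0; rewrite /p1_eq !pair_neq0 /= => /and3P[nu nv /eqP E].
rewrite !mulf_eq0 (negPf c0) (negPf c'0) nu nv /=; apply/eqP.
by transitivity (c * c' * (a * b')); [|rewrite E]; ring.
Qed.

(** * Division by a monic polynomial *)

(** The quotient of R[y] by a monic d is free over R, hence torsion free. *)
Lemma monic_dvd_unscale (R : idomainType) (d g b : {poly R}) (c : R) :
  d \is monic -> c != 0 -> c *: g = b * d -> exists b', g = b' * d.
Proof.
move=> dm c0 E; exists (rdivp g d).
rewrite [LHS](Pdiv.RingMonic.rdivp_eq dm g).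
have /eqP : c *: rmodp g d = 0.
  by rewrite -Pdiv.RingMonic.rmodpZ // E Pdiv.RingMonic.rmodp_mull.
by rewrite -mul_polyC mulf_eq0 polyC_eq0 (negPf c0) => /eqP ->; rewrite addr0.
Qed.

(** * The function w and its values *)

Section RationalFunction.
Variable F : fieldType.
Variables eps delta : F.

(** Substituting into the ideal any point, with coordinates in an F-algebra, of
    the first quadric X^2 = T Z.  The second quadric is kept as a factor, so
    that one may specialize to a ring in which it does not vanish but which is
    easier to compute in than the coordinate ring of the curve. *)
Lemma jq_ideal_mmap (S : comNzRingType) (f : {rmorphism F -> S}) (X Y T Z : S) p :
  X ^+ 2 = T * Z -> jq_ideal eps delta p ->
  exists b, mmap f (fun i : 'I_4 => nth 0 [:: X; Y; T; Z] i) p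
    = b * (Y ^+ 2 - (f eps * T ^+ 2 + f (2 * delta) * X ^+ 2 + Z ^+ 2)).
Proof.
move=> XE [a [b ->]]; set h := fun i : 'I_4 => _.
exists (mmap f h b).
have hU i : mmap f h 'X_i = h i by rewrite mmapX mmap1U.
rewrite /Defs.mX /Defs.mY /Defs.mT /Defs.mZ.
move: (2 * delta) => d2; rewrite !(rmorphB, rmorphN, rmorphD, rmorphM).
by rewrite /= !mmapZ !rmorphXn /= !hU /h /= -!expr2 XE; ring.
Qed.

Lemma jq_ideal_vanish P p :
  on_jq eps delta P -> jq_ideal eps delta p -> p.@[coord4 P] = 0.
Proof.
case/and3P => _ /eqP hX /eqP hY.
case/(jq_ideal_mmap idfun (cY P) hX) => b; rewrite hY subrr mulr0 => <-.
exact: meval_eq.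
Qed.

Variable s : F.

Lemma jq_w_is_ratfun : is_ratfun eps delta (jq_w eps s).
Proof.
split.
  have hU i k : 'X_i ^+ k \is [in F[4], (1 * k).-homog].
    by apply: dhomogMn; rewrite dhomogX /= mdeg1.
  have hXZ : Defs.mX F ^+ 2 * Defs.mZ F ^+ 2 \is [in F[4], 4.-homog].
    exact: dhomogM (hU _ 2) (hU _ 2).
  exists 4; split; apply: rpredB.
  - exact: rpredZ.
  - by apply: rpredZ; exact: hU.
  - exact: hU.
  - exact: rpredZ.
(* The denominator is 1 at the neutral element (0 : 1 : 0 : 1). *)
have on0 : on_jq eps delta (Pt4 0 1 0 1).
  by rewrite /on_jq /pt_nz /= oner_neq0 orbT; apply/and3P;
    split=> //; apply/eqP; ring.
move=> /(jq_ideal_vanish on0)/eqP.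
rewrite /jq_w /Defs.mX /Defs.mZ /= mevalB mevalZ !mevalM !mevalXU /coord4 /=.
by rewrite !mul0r !mulr0 subr0 !mulr1 oner_eq0.
Qed.

(** On the curve the two forms of [jq_w] are Z^2 times [w_num] and [w_den];
    unlike them, these have no common zero there as soon as s^2 <> eps. *)
Definition w_num (P : pt4 F) := cT P * (s * cZ P - eps * cT P).
Definition w_den (P : pt4 F) := cZ P * (cZ P - s * cT P).

Lemma jq_w_meval P : on_jq eps delta P ->
  (jq_w eps s).1.@[coord4 P] = cZ P ^+ 2 * w_num P /\
  (jq_w eps s).2.@[coord4 P] = cZ P ^+ 2 * w_den P.
Proof.
case/and3P => _ /eqP hX _.
rewrite /jq_w /Defs.mX /Defs.mZ /= !mevalB !mevalZ !mevalM !mevalXU /coord4 /=.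
rewrite /w_num /w_den; split; ring: hX.
Qed.

Hypothesis eps0 : eps != 0.

Lemma jq_finite_or_inf P : on_jq eps delta P ->
  cZ P != 0 \/ [/\ cX P = 0, cT P != 0, cZ P = 0 & cY P ^+ 2 = eps * cT P ^+ 2].
Proof.
case/and3P=> nz /eqP hX /eqP hY.
have [Z0|] := eqVneq (cZ P) 0; [right | by left].
have X0 : cX P = 0 by apply/eqP; rewrite -sqrf_eq0 hX Z0 mulr0.
have YE : cY P ^+ 2 = eps * cT P ^+ 2 by rewrite hY X0 Z0; ring.
split=> //; apply: contraTneq nz => T0.
by rewrite /pt_nz X0 Z0 T0 eqxx !orbF /= negbK -sqrf_eq0 YE T0 expr0n mulr0.
Qed.

Lemma w_num_den_neq0 P : s ^+ 2 != eps -> on_jq eps delta P ->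
  (w_num P, w_den P) != 0.
Proof.
move=> se /jq_finite_or_inf onP; apply/negP.
rewrite -[0]/(0, 0) xpair_eqE => /andP[].
rewrite /w_num /w_den !mulf_eq0; case: onP => [Zn|[_ Tn -> _]]; last first.
  by rewrite (negPf Tn) /= mulr0 sub0r oppr_eq0 mulf_eq0 (negPf eps0) (negPf Tn).
rewrite (negPf Zn) /= => + ; rewrite !subr_eq0 => + /eqP ZE.
have Tn : cT P != 0 by apply: contraNneq Zn => T0; rewrite ZE T0 mulr0.
rewrite (negPf Tn) /= ZE mulrA => /eqP/(mulIf Tn)/eqP; exact/negP.
Qed.

(** w has a pole at infinity.  With T fixed to its value at the point, the curve
    is parametrized by x = X and y = Y, with Z = x^2 / T, and has equation
    y^2 = f(x).  There the forms of w become x^4 n and x^6 d with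
    n(0) = - eps.  From w = w'.1 / w'.2 one gets, in F[x][y] and modulo
    y^2 - f, first x^4 (n w'.2 - x^2 d w'.1) = 0, then
    n w'.2 - x^2 d w'.1 = 0, whence - eps w'.2 = 0 at the point. *)
Lemma jq_w_pole_at_inf P w' : cX P = 0 -> cT P != 0 -> cZ P = 0 ->
  cY P ^+ 2 = eps * cT P ^+ 2 ->
  ratfun_eqv eps delta (jq_w eps s) w' -> w'.2.@[coord4 P] = 0.
Proof.
case: P w' => X Y T Z [w1 w2] /= -> T0 -> YE; rewrite /ratfun_eqv.
pose t : {poly {poly F}} := T%:P%:P.
pose x : {poly {poly F}} := 'X%:P.
pose z : {poly {poly F}} := (T^-1 *: 'X^2)%:P.
have XE : x ^+ 2 = t * z.
  by rewrite /x /t /z -polyCM -polyC_exp -mul_polyC mulrA -polyCM mulfV // mul1r.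
pose h := fun i : 'I_4 => [:: x; 'X; t; z]`_i.
case/(jq_ideal_mmap (polyC \o polyC) 'X XE) => b; rewrite -/h.
move: (2 * delta) => d2.
have evE p : (mmap (polyC \o polyC) h p).[Y%:P].[0] = p.@[coord4 (Pt4 0 Y T 0)].
  rewrite /meval /mmap horner_sum horner_sum; apply: eq_bigr => m _.
  rewrite hornerM hornerC hornerM hornerC; congr (_ * _).
  rewrite /mmap1 !horner_prod; apply: eq_bigr => i _.
  rewrite !horner_exp; congr (_ ^+ _).
  case: i => [[|[|[|[|//]]]]] lti; rewrite /h /coord4 /= ?hornerX ?hornerC
    ?hornerX //.
  by rewrite hornerZ hornerXn expr0n mulr0.
have hU i : mmap (polyC \o polyC) h 'X_i = h i by rewrite mmapX mmap1U.
have numE : mmap (polyC \o polyC) h (jq_w eps s).1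
    = ('X^4 * ((s / T ^+ 2) *: 'X^2 - eps%:P))%:P.
  rewrite rmorphB /= !mmapZ (rmorphM _ (Defs.mX F ^+ 2)) 3!rmorphXn /=.
  rewrite /Defs.mX /Defs.mZ !hU /h /=.
  rewrite /x /z -!polyC_exp -!polyCM -polyCB exprZn -!mul_polyC; congr polyC.
  by rewrite exprVn (polyCM s); ring.
have denE : mmap (polyC \o polyC) h (jq_w eps s).2
    = ('X^6 * ((T ^- 4) *: 'X^2 - (s / T ^+ 2)%:P))%:P.
  rewrite rmorphB /= !mmapZ (rmorphM _ (Defs.mX F ^+ 2)) 3!rmorphXn /=.
  rewrite /Defs.mX /Defs.mZ !hU /h /=.
  rewrite /x /z -!polyC_exp -!polyCM -polyCB !exprZn -!mul_polyC; congr polyC.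
  by rewrite !exprVn (polyCM s); ring.
case: (jq_w eps s) numE denE => N D /= numE denE.
rewrite rmorphB !rmorphM /= numE denE.
set f1 := mmap _ _ w1; set f2 := mmap _ _ w2.
set f := (_ + _ + z ^+ 2).
set n := (_ *: _ - _); set d := (_ *: _ - _) => E.
pose f0 : {poly F} := eps%:P * T%:P ^+ 2 + d2%:P * 'X ^+ 2 + (T^-1 *: 'X^2) ^+ 2.
have fE : f = f0%:P.
  by rewrite /f0 2!polyCD (polyCM eps%:P) (polyCM d2%:P) !polyC_exp.
have fm : 'X ^+ 2 - f \is monic.
  rewrite fE monicE lead_coefDl ?lead_coefXn //.
  by rewrite size_polyXn size_polyN (leq_ltn_trans (size_polyC_leq1 _)).
have [b' E'] : exists b', n%:P * f2 - f1 * ('X^2 * d)%:P = b' * ('X ^+ 2 - f).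
  apply: (monic_dvd_unscale (c := 'X^4) (b := b) fm).
    by rewrite expf_neq0 ?polyX_eq0.
  rewrite -E -!mul_polyC !polyCM; ring.
rewrite -evE -/f2; apply/eqP.
have f0E : f0.[0] = Y ^+ 2.
  by rewrite /f0 YE !expr2 !(hornerD, hornerM, hornerZ, hornerC, hornerX); ring.
have fYE : ('X ^+ 2 - f).[Y%:P].[0] = 0.
  rewrite fE hornerD hornerN hornerXn hornerC hornerD hornerN -polyC_exp.
  by rewrite hornerC f0E subrr.
have : ((n%:P * f2 - f1 * ('X^2 * d)%:P).[Y%:P]).[0] = 0.
  by rewrite E' !hornerM fYE mulr0.
rewrite !(hornerD, hornerN, hornerM, hornerZ, hornerC, hornerX).
rewrite !(mul0r, mulr0) subr0 sub0r.
by move=> /eqP; rewrite mulNr oppr_eq0 mulf_eq0 (negPf eps0).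
Qed.

Lemma ratfun_at_jq_w P : s ^+ 2 != eps -> on_jq eps delta P ->
  p1_eq (ratfun_at eps delta (jq_w eps s) P) (w_num P, w_den P).
Proof.
move=> se onP; have nz := w_num_den_neq0 se onP.
have [NE DE] := jq_w_meval onP.
rewrite /ratfun_at; case: pselect => [h|nreg].
  case: (cid h) => w' /= [_ eqv den].
  rewrite /p1_eq nz pair_neq0 oner_neq0 orbT /= mulr1.
  rewrite -(inj_eq (mulIf den)) mulrAC divfK //.
  case: (jq_finite_or_inf onP) => [Zn|[X0 Tn Z0 YE]]; last first.
    by rewrite (jq_w_pole_at_inf X0 Tn Z0 YE eqv) eqxx in den.
  have /eqP := jq_ideal_vanish onP eqv.
  rewrite mevalB !mevalM NE DE subr_eq0 => /eqP E.
  by apply/eqP/(mulfI (expf_neq0 2 Zn)); rewrite mulrCA -E mulrA.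
rewrite /p1_eq nz pair_neq0 oner_neq0 /= mul1r mulr0.
apply: contra_notT nreg => dn; exists (jq_w eps s); split.
- exact: jq_w_is_ratfun.
- exists 0, 0; rewrite subrr; ring.
rewrite DE mulf_neq0 // expf_neq0 //.
by apply: contraNneq dn => Z0; rewrite /w_den Z0 mul0r.
Qed.

End RationalFunction.

Lemma jq_w_even (F : fieldType) (eps delta s : F) :
  eps != 0 -> s ^+ 2 != eps -> even_ratfun eps delta (jq_w eps s).
Proof.
move=> e0 se L iota P onP /=.
have -> : (map_mpoly iota (s *: (Defs.mX F ^+ 2 * Defs.mZ F ^+ 2)
                           - eps *: Defs.mX F ^+ 4),
    map_mpoly iota (Defs.mZ F ^+ 4 - s *: (Defs.mX F ^+ 2 * Defs.mZ F ^+ 2)))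
  = jq_w (iota eps) (iota s).
  rewrite /jq_w /Defs.mX /Defs.mZ.
  have hX i : map_mpoly iota 'X_i = 'X_i :> {mpoly L[4]} by rewrite map_mpolyX.
  by congr pair;
    rewrite rmorphB /= !map_mpolyZ (rmorphM _ (_ ^+ 2)) 3!rmorphXn /= !hX.
have e0' : iota eps != 0 by rewrite fmorph_eq0.
have se' : iota s ^+ 2 != iota eps by rewrite -rmorphXn (inj_eq (fmorph_inj _)).
have onN : on_jq (iota eps) (iota delta) (jq_opp P).
  by move: onP; rewrite /on_jq /pt_nz /= oppr_eq0 sqrrN.
apply: (p1_eq_trans (ratfun_at_jq_w e0' se' onN)).
by rewrite p1_eq_sym; exact: (ratfun_at_jq_w e0' se' onP).
Qed.

(** * Doubling and differential addition *)

Section Identities.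
Variables (F : fieldType) (s s' delta : F).
Hypothesis two_neq0 : (2 : F) != 0.
Hypotheses (s0 : s != 0) (s'0 : s' != 0) (ss' : s != s').
Hypothesis sum_s : s + s' = - (2 * delta).

Local Notation eps := (s * s').
Local Notation N := (w_num eps s).
Local Notation D := (w_den s).

Lemma on_jq_factor P : on_jq eps delta P ->
  cX P ^+ 2 = cT P * cZ P /\ cY P ^+ 2 = (cZ P - s * cT P) * (cZ P - s' * cT P).
Proof.
case/and3P=> _ /eqP hX /eqP hY; split=> //.
rewrite hY hX; have -> : 2 * delta = - (s + s') by rewrite sum_s opprK.
ring.
Qed.

Lemma jq_nonsing : eps * (delta ^+ 2 - eps) != 0.
Proof.
rewrite !mulf_neq0 //; apply: contraNneq ss' => disc0.
have /eqP : (s - s') ^+ 2 = 0.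
  transitivity ((s + s') ^+ 2 - 4 * eps); first by ring.
  by rewrite sum_s -(mulr0 4) -disc0; ring.
by rewrite sqrf_eq0 subr_eq0.
Qed.

Lemma sq_s_neq : s ^+ 2 != eps.
Proof. by rewrite expr2 (inj_eq (mulfI s0)). Qed.

Lemma jq_on_add P Q : on_jq eps delta P -> on_jq eps delta Q ->
  on_jq eps delta (jq_add eps delta P Q).
Proof. exact: jq_add_on two_neq0 jq_nonsing. Qed.

Lemma w_neq0 P : on_jq eps delta P -> (N P, D P) != 0.
Proof. by apply: w_num_den_neq0 sq_s_neq; rewrite mulf_neq0. Qed.

Lemma w_double P : on_jq eps delta P ->
  p1_eq (N (jq_add eps delta P P), D (jq_add eps delta P P))
    (4 * N P * D P * ((N P + D P) ^+ 2 - 4 * s' / s * N P * D P),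
     (N P ^+ 2 - D P ^+ 2) ^+ 2).
Proof.
move=> onP; have onA := jq_on_add onP onP; have [hX hY] := on_jq_factor onP.
(* The second law vanishes identically on the diagonal, so the first cannot. *)
have addE : jq_add eps delta P P = jq_law1 eps delta P P.
  move: onA; rewrite /jq_add; case: ifPn => // _ /and3P[+ _ _].
  rewrite /pt_nz /= !subrr !mul0r expr0n eqxx /= orbF.
  have -> : 2 * delta = - (s + s') by rewrite sum_s opprK.
  move=> /negP[]; apply/eqP; ring: hX hY.
have nz := w_neq0 onA.
suff <- : (N (jq_add eps delta P P), D (jq_add eps delta P P)) =
    (4 * N P * D P * ((N P + D P) ^+ 2 - 4 * s' / s * N P * D P),
     (N P ^+ 2 - D P ^+ 2) ^+ 2).
  by rewrite /p1_eq nz /=.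
rewrite addE /w_num /w_den /=; congr pair; field: hX hY => //.
Qed.

Section Sum.
Variables P Q : pt4 F.
Hypotheses (onP : on_jq eps delta P) (onQ : on_jq eps delta Q).

(** [jq_law1] sends (P, Q) to a point with T = a^2, Z = b^2, and (Q, - P) to one
    with T = a'^2, Z = b^2; [jq_law2] sends (Q, - P) to one with T = t^2,
    Z = a^2. *)
Let a := cX P * cY Q + cX Q * cY P.
Let a' := cX Q * cY P - cX P * cY Q.
Let b := cZ P * cZ Q - eps * cT P * cT Q.
Let t := cT Q * cZ P - cT P * cZ Q.
Let U (r : F) :=
  cZ P * cZ Q + eps * cT P * cT Q - r * (cT P * cZ Q + cT Q * cZ P).

Lemma sum_diff : a * a' = t * b.
Proof.
have [[hX1 hY1] [hX2 hY2]] := (on_jq_factor onP, on_jq_factor onQ).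
by rewrite /a /a' /t /b; ring: hX1 hY1 hX2 hY2.
Qed.

(** The two sides differ by 4 T_P T_Q Z_P Z_Q (r^2 + 2 delta r + eps), and s, s'
    are the roots of that quadratic. *)
Lemma U_sq r : (r == s) || (r == s') ->
  U r ^+ 2 = b ^+ 2 - r * (a ^+ 2 + a' ^+ 2) + r ^+ 2 * t ^+ 2.
Proof.
have [[hX1 hY1] [hX2 hY2]] := (on_jq_factor onP, on_jq_factor onQ).
by case/orP=> /eqP ->; rewrite /a /a' /t /b /U; ring: hX1 hY1 hX2 hY2.
Qed.

Lemma w_cross : N P * D Q - N Q * D P = - (s * t * U s').
Proof. rewrite /t /U /w_num /w_den; ring. Qed.

Lemma w_dot : N P * N Q - D P * D Q = - (b * U s).
Proof. rewrite /b /U /w_num /w_den; ring. Qed.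

(** For the coordinates of [jq_law1], the left side is the product over P + Q and
    Q - P of the form Z - r T, which divides N for r = s' and D for r = s. *)
Lemma U_sq_factor r : (r == s) || (r == s') ->
  (b ^+ 2 - r * a ^+ 2) * (b ^+ 2 - r * a' ^+ 2) = b ^+ 2 * U r ^+ 2.
Proof.
move=> hr; rewrite U_sq //.
transitivity (b ^+ 4 - r * b ^+ 2 * (a ^+ 2 + a' ^+ 2) + r ^+ 2 * (a * a') ^+ 2).
  by ring.
by rewrite sum_diff; ring.
Qed.

Lemma w_diff_add :
  let A := jq_add eps delta P Q in
  let B := jq_add eps delta Q (jq_opp P) in
  N B * D B != 0 ->
  p1_eq (N A, D A)
    (D B * (N P * D Q - N Q * D P) ^+ 2, N B * (N P * N Q - D P * D Q) ^+ 2).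
Proof.
move=> A B; rewrite mulf_eq0 negb_or => /andP[NB0 DB0].
have hs : (s == s) || (s == s') by rewrite eqxx.
have hs' : (s' == s) || (s' == s') by rewrite eqxx orbT.
have nzA : (N A, D A) != 0 by apply: w_neq0; exact: jq_on_add.
rewrite w_cross w_dot !sqrrN /p1_eq nzA /=.
(* If b = 0, then Q - P is computed by the second law: the first would make
   D B vanish. *)
have [b0|bn] := eqVneq b 0.
  have Bnz1 : ~~ pt_nz (jq_law1 eps delta Q (jq_opp P)).
    apply: contra DB0 => nz; rewrite /w_den /B /jq_add nz /=.
    have -> : cZ Q * cZ P - eps * cT Q * cT P = b by rewrite /b; ring.
    by rewrite b0 expr0n mul0r.
  have BT : cT B = t ^+ 2 by rewrite /B /jq_add (negPf Bnz1).
  have BZ : cZ B = a ^+ 2.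
    by rewrite /B /jq_add (negPf Bnz1) /= /a; ring.
  have a'0 : a' = 0.
    move: Bnz1; rewrite /pt_nz !negb_or !negbK => /and4P[_ _ + _].
    by rewrite /= sqrf_eq0 mulNr => /eqP.
  have an : a != 0.
    by apply: contraNneq DB0 => a0; rewrite /w_den BZ a0 expr0n mul0r.
  have AE : A = jq_law1 eps delta P Q.
    by rewrite /A /jq_add /pt_nz /= sqrf_eq0 -/a an !orbT.
  have DA : D A = 0 by rewrite /w_den AE /= -/b b0 expr0n mul0r.
  have Us' : U s' ^+ 2 = - s' * (a ^+ 2 - s' * t ^+ 2).
    by rewrite (U_sq hs') b0 a'0; ring.
  have NBE : N B = s * t ^+ 2 * (a ^+ 2 - s' * t ^+ 2).
    by rewrite /w_num BT BZ; ring.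
  rewrite DA b0 mul0r expr0n !mulr0 eqxx andbT pair_neq0 eqxx orbF.
  have tn : t != 0.
    by apply: contraNneq NB0 => t0; rewrite NBE t0 expr0n mulr0 mul0r.
  have un : a ^+ 2 - s' * t ^+ 2 != 0.
    by apply: contraNneq NB0 => u0; rewrite NBE u0 mulr0.
  rewrite exprMn Us'; apply: mulf_neq0 => //; apply: mulf_neq0.
    by rewrite expf_neq0 // mulf_neq0.
  by rewrite mulf_neq0 ?oppr_eq0.
have AE : A = jq_law1 eps delta P Q.
  by rewrite /A /jq_add /pt_nz /= !sqrf_eq0 -/b bn !orbT.
have bE : cZ Q * cZ P - eps * cT Q * cT P = b by rewrite /b; ring.
have BE : B = jq_law1 eps delta Q (jq_opp P).
  by rewrite /B /jq_add /pt_nz /= bE !sqrf_eq0 bn !orbT.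
have NAE : N A = s * a ^+ 2 * (b ^+ 2 - s' * a ^+ 2).
  by rewrite /w_num AE /= -/a -/b; ring.
have DAE : D A = b ^+ 2 * (b ^+ 2 - s * a ^+ 2) by rewrite /w_den AE.
have NBE : N B = s * a' ^+ 2 * (b ^+ 2 - s' * a' ^+ 2).
  by rewrite /w_num BE /= bE mulNr -/a'; ring.
have DBE : D B = b ^+ 2 * (b ^+ 2 - s * a' ^+ 2).
  by rewrite /w_den BE /= bE mulNr -/a'.
have Fs := U_sq_factor hs; have Fs' := U_sq_factor hs'.
apply/andP; split; last first.
  apply/eqP; transitivity (s ^+ 2 * (a * a') ^+ 2 * b ^+ 2 * U s ^+ 2
      * ((b ^+ 2 - s' * a ^+ 2) * (b ^+ 2 - s' * a' ^+ 2))).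
    by rewrite NAE NBE; ring.
  transitivity (s ^+ 2 * t ^+ 2 * b ^+ 4 * U s' ^+ 2
      * ((b ^+ 2 - s * a ^+ 2) * (b ^+ 2 - s * a' ^+ 2))).
    by rewrite Fs Fs' sum_diff; ring.
  by rewrite DAE DBE; ring.
(* If the right-hand pair were (0, 0), U s = 0 would give b^2 = s a^2; then
   t = 0 would give a a' = 0, and U s' = 0 would give b^2 = s' a^2. *)
rewrite pair_neq0 -negb_and; apply/negP => /andP[].
rewrite (mulf_eq0 (D B)) (mulf_eq0 (N B)) (negPf DB0) (negPf NB0) /=.
rewrite !sqrf_eq0 -mulrA.
rewrite mulf_eq0 (negPf s0) !mulf_eq0 (negPf bn) /= => tU /eqP Us.
have a'n : a' != 0.
  by apply: contraNneq NB0 => a0; rewrite NBE a0 expr0n mulr0 mul0r.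
have us' : b ^+ 2 - s' * a' ^+ 2 != 0.
  by apply: contraNneq NB0 => u0; rewrite NBE u0 mulr0.
have us : b ^+ 2 - s * a' ^+ 2 != 0.
  by apply: contraNneq DB0 => u0; rewrite DBE u0 mulr0.
have ba : b ^+ 2 = s * a ^+ 2.
  by apply/eqP; rewrite -subr_eq0 -(inj_eq (mulIf us)) mul0r Fs Us expr0n mulr0.
have an : a != 0.
  by apply: contraNneq bn => a0; rewrite -sqrf_eq0 ba a0 expr0n mulr0.
case/orP: tU => [/eqP t0|/eqP Us'0].
  by move/eqP: sum_diff; rewrite t0 mul0r mulf_eq0 (negPf an) (negPf a'n).
have ba' : b ^+ 2 = s' * a ^+ 2.
  by apply/eqP; rewrite -subr_eq0 -(inj_eq (mulIf us')) mul0r Fs' Us'0 expr0n mulr0.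
by move/eqP: ss'; apply; apply: (mulIf (expf_neq0 2 an)); rewrite -ba -ba'.
Qed.

End Sum.
End Identities.

(** * The inverted Montgomery-like property *)

Theorem proposition8 (F : finFieldType) (eps delta r : F)
    (hchar : 2%N \notin [pchar F])
    (hnonsing : eps * (delta ^+ 2 - eps) != 0)
    (hchi : quad_char (delta ^+ 2 - eps) = 1)
    (hr : r ^+ 2 = delta ^+ 2 - eps) :
  let s := - delta - r in
  inverted_montgomery_like eps delta (jq_w eps s)
    (4 * (- delta + r) / (- delta - r)).
Proof.
move=> s; set s' := - delta + r.
have two_neq0 : (2 : F) != 0 by move: hchar; rewrite inE /=.
have epsE : eps = s * s'.
  by transitivity (delta ^+ 2 - r ^+ 2); [rewrite hr|rewrite /s /s']; ring.
have sum_s : s + s' = - (2 * delta) by rewrite /s /s'; ring.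
move: hnonsing; rewrite -hr mulf_eq0 negb_or sqrf_eq0 => /andP[e0 r0].
have ss' : s != s'.
  rewrite /s /s' (inj_eq (addrI _)) -subr_eq0 -opprD oppr_eq0 -mulr2n.
  by rewrite -mulr_natl mulf_neq0.
have [s0 s'0] : s != 0 /\ s' != 0.
  by apply/andP; rewrite -negb_or -mulf_eq0 -epsE.
have se : s ^+ 2 != eps by rewrite epsE sq_s_neq.
rewrite -/s -/s'; clearbody s s'; subst eps.
split; [exact: jq_w_is_ratfun | exact: jq_w_even |].
move=> P1 P2 onP1 onP2 W0 Z0 W1 Z1 W2 Z2 W3 Z3 W4 Z4.
have on_add P Q := jq_on_add two_neq0 s0 s'0 ss' sum_s (P := P) (Q := Q).
have onN : on_jq (s * s') delta (jq_opp P1).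
  by move: onP1; rewrite /on_jq /pt_nz /= oppr_eq0 sqrrN.
have val P W Z : on_jq (s * s') delta P ->
    p1_eq (W, Z) (ratfun_at (s * s') delta (jq_w (s * s') s) P) ->
    exists2 c, c != 0 & W = c * w_num (s * s') s P /\ Z = c * w_den s P.
  move=> onP /p1_eq_trans/(_ (ratfun_at_jq_w e0 se onP)).
  by case/p1_eq_scaleP=> _ [c c0 [-> ->]]; exists c.
move=> /(val _ _ _ (on_add _ _ onP2 onN))[c0 c0n [-> ->]].
move=> /(val _ _ _ onP1)[c1 c1n [-> ->]] /(val _ _ _ onP2)[c2 c2n [-> ->]].
move=> /(val _ _ _ (on_add _ _ onP1 onP2))[c3 c3n [-> ->]].
move=> /(val _ _ _ (on_add _ _ onP1 onP1))[c4 c4n [-> ->]].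
rewrite mulrACA mulf_eq0 => /norP[_ ND0]; split.
- have := p1_eq_scale c4n (expf_neq0 4 c1n)
    (w_double two_neq0 s0 s'0 ss' sum_s onP1).
  by congr (p1_eq _ (_, _)); ring.
(* The right-hand side is homogeneous of degree 1 in (W0, Z0) and of degree 2
   in each of (W1, Z1) and (W2, Z2). *)
have cn : c0 * (c1 * c2) ^+ 2 != 0 by rewrite !mulf_neq0 ?expf_neq0 ?mulf_neq0.
have := p1_eq_scale c3n cn (w_diff_add two_neq0 s0 s'0 ss' sum_s onP1 onP2 ND0).
by congr (p1_eq _ (_, _)); ring.
Qed.
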